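(* Let $n\neq 1$ be a real number, $k_n=n-1$, and $k_0\in\mathbb{R}$. On the phase space with canonical coordinates $(r,\phi,p_r,p_\phi)$, $r>0$, consider $$H_{nc}=\tfrac12 r^{2n}\Big(p_r^2+\tfrac{p_\phi^2}{r^2}\Big)+k_0r^{n-1}.$$ With $P_1=r^n\big(p_r\cos(k_n\phi)+\tfrac1r p_\phi\sin(k_n\phi)\big)$ and $P_2=r^n\big(p_r\sin(k_n\phi)-\tfrac1r p_\phi\cos(k_n\phi)\big)$, the functions $$J_1=p_\phi,\qquad J_2=P_2p_\phi-k_0\cos(k_n\phi),\qquad J_3=P_1p_\phi+k_0\sin(k_n\phi)$$ are constants of motion of $H_{nc}$, i.e. they Poisson commute with $H_{nc}$; hence $H_{nc}$ is superintegrable.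
   Context: The Poisson bracket is the canonical one in $(r,\phi,p_r,p_\phi)$. A constant of motion of $H$ is a function $F$ with $\{F,H\}=0$. *)

(* Defs.v *)
From Stdlib Require Import Reals.
From Coquelicot Require Import Coquelicot.
Open Scope R_scope.

Definition phase_fun := R -> R -> R -> R -> R.

Definition poisson (F G : phase_fun) (r phi pr pphi : R) : R :=
    Derive (fun x => F x phi pr pphi) r * Derive (fun x => G r phi x pphi) pr
  - Derive (fun x => F r phi x pphi) pr * Derive (fun x => G x phi pr pphi) r
  + Derive (fun x => F r x pr pphi) phi * Derive (fun x => G r phi pr x) pphi
  - Derive (fun x => F r phi pr x) pphi * Derive (fun x => G r x pr pphi) phi.

Definition kn (n : R) : R := n - 1.

Definition Hnc (n k0 : R) : phase_fun := fun r phi pr pphi =>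
  / 2 * Rpower r (2 * n) * (pr ^ 2 + pphi ^ 2 / r ^ 2) + k0 * Rpower r (n - 1).

Definition P1 (n : R) : phase_fun := fun r phi pr pphi =>
  Rpower r n * (pr * cos (kn n * phi) + / r * pphi * sin (kn n * phi)).

Definition P2 (n : R) : phase_fun := fun r phi pr pphi =>
  Rpower r n * (pr * sin (kn n * phi) - / r * pphi * cos (kn n * phi)).

Definition J1 : phase_fun := fun r phi pr pphi => pphi.

Definition J2 (n k0 : R) : phase_fun := fun r phi pr pphi =>
  P2 n r phi pr pphi * pphi - k0 * cos (kn n * phi).

Definition J3 (n k0 : R) : phase_fun := fun r phi pr pphi =>
  P1 n r phi pr pphi * pphi + k0 * sin (kn n * phi).

(* Main.v *)
(* In the variable
   a = r^n one has H = a^2/2 (p_r^2 + p_phi^2/r^2) + k0 a/r, and H does not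
   depend on phi, so {J1, H} = -dH/dphi = 0; for J2 and J3 the four terms of
   the bracket cancel identically because da/dr = n a/r and k_n = n - 1. *)
Require Import Defs.
From Stdlib Require Import Reals Lra.
From Coquelicot Require Import Coquelicot.
Open Scope R_scope.

Definition has_gradient (F : phase_fun) (r phi pr pphi : R)
    (Fr Fphi Fpr Fpphi : R) : Prop :=
  is_derive (fun x => F x phi pr pphi) r Fr /\
  is_derive (fun x => F r x pr pphi) phi Fphi /\
  is_derive (fun x => F r phi x pphi) pr Fpr /\
  is_derive (fun x => F r phi pr x) pphi Fpphi.

Lemma poisson_gradient {F G : phase_fun} {r phi pr pphi : R}
    {Fr Fphi Fpr Fpphi Gr Gphi Gpr Gpphi : R} :
  has_gradient F r phi pr pphi Fr Fphi Fpr Fpphi ->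
  has_gradient G r phi pr pphi Gr Gphi Gpr Gpphi ->
  poisson F G r phi pr pphi = Fr * Gpr - Fpr * Gr + Fphi * Gpphi - Fpphi * Gphi.
Proof.
  intros (F1 & F2 & F3 & F4) (G1 & G2 & G3 & G4); unfold poisson.
  apply is_derive_unique in F1, F2, F3, F4, G1, G2, G3, G4.
  simpl in *; now rewrite F1, F2, F3, F4, G1, G2, G3, G4.
Qed.

Lemma Rpower_mult_2 (x a : R) : Rpower x (2 * a) = Rpower x a ^ 2.
Proof.
  unfold Rpower; rewrite <- Rsqr_pow2; unfold Rsqr.
  rewrite <- exp_plus; f_equal; ring.
Qed.

Lemma Rpower_minus_1 (x a : R) : 0 < x -> Rpower x (a - 1) = Rpower x a / x.
Proof.
  intros hx; unfold Rpower.
  replace ((a - 1) * ln x) with (a * ln x + - ln x) by ring.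
  now rewrite exp_plus, exp_Ropp, exp_ln.
Qed.

(* [auto_derive] differentiates [Rpower x e] as [exp (e * ln x)]; folding
   back lets every power of [r] be expressed through [Rpower r n]. *)
Ltac solve_partial :=
  unfold Hnc, J1, J2, J3, P1, P2, Rpower;
  auto_derive;
  [ repeat split; try lra; intro; nra
  | repeat match goal with |- context [exp (?e * ln ?x)] =>
             change (exp (e * ln x)) with (Rpower x e) end;
    rewrite ?Rpower_mult_2, ?Rpower_minus_1 by lra;
    unfold kn; field; lra ].

Ltac solve_gradient := split; [|split; [|split]]; solve_partial.

Section Gradients.

Variables (n k0 r phi pr pphi : R).
Hypothesis hr : 0 < r.

Let a := Rpower r n.
Let c := cos (kn n * phi).
Let s := sin (kn n * phi).

Lemma Hnc_gradient :
  has_gradient (Hnc n k0) r phi pr pphi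
    (n * a ^ 2 / r * (pr ^ 2 + pphi ^ 2 / r ^ 2) - a ^ 2 * pphi ^ 2 / r ^ 3
       + k0 * (n - 1) * a / r ^ 2)
    0 (a ^ 2 * pr) (a ^ 2 * pphi / r ^ 2).
Proof. unfold a; solve_gradient. Qed.

Lemma J1_gradient : has_gradient J1 r phi pr pphi 0 0 0 1.
Proof. solve_gradient. Qed.

Lemma J2_gradient :
  has_gradient (J2 n k0) r phi pr pphi
    (n * a / r * (pr * s - pphi * c / r) * pphi + a * pphi ^ 2 * c / r ^ 2)
    (kn n * (a * (pr * c + pphi * s / r) * pphi + k0 * s))
    (a * s * pphi)
    (a * (pr * s - 2 * pphi * c / r)).
Proof. unfold a, c, s; solve_gradient. Qed.

Lemma J3_gradient :
  has_gradient (J3 n k0) r phi pr pphi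
    (n * a / r * (pr * c + pphi * s / r) * pphi - a * pphi ^ 2 * s / r ^ 2)
    (kn n * (a * (pphi * c / r - pr * s) * pphi + k0 * c))
    (a * c * pphi)
    (a * (pr * c + 2 * pphi * s / r)).
Proof. unfold a, c, s; solve_gradient. Qed.

End Gradients.

Theorem mainTheorem6 (n k0 : R) (hn : n <> 1) :
  forall r phi pr pphi : R, 0 < r ->
    poisson J1 (Hnc n k0) r phi pr pphi = 0 /\
    poisson (J2 n k0) (Hnc n k0) r phi pr pphi = 0 /\
    poisson (J3 n k0) (Hnc n k0) r phi pr pphi = 0.
Proof.
  (* The bracket identities hold for every n. *)
  intros r phi pr pphi hr.
  pose proof (Hnc_gradient n k0 r phi pr pphi hr) as hH.
  rewrite (poisson_gradient (J1_gradient r phi pr pphi) hH),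
    (poisson_gradient (J2_gradient n k0 r phi pr pphi hr) hH),
    (poisson_gradient (J3_gradient n k0 r phi pr pphi hr) hH).
  unfold kn; repeat split; field; lra.
Qed.
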